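(* Let $\mathbf 1 \in \mathbb{R}^{n\times n}$ be the all ones matrix and let $\epsilon>0$. Let $\mathbf S \in \mathbb{R}^{n\times n}$ be any matrix such that $\|\mathbf 1 - \mathbf S\|_2 \le \epsilon n$. Then for any positive semidefinite matrix $\mathbf A \in \mathbb{R}^{n\times n}$ with bounded entries, $\|\mathbf A - \mathbf A\circ \mathbf S\|_2 \le \epsilon n$.
   Context: A matrix $\mathbf A$ has bounded entries if $\max_{i,j}|\mathbf A_{ij}| \le 1$. $\circ$ denotes the entrywise (Hadamard) product and $\|\cdot\|_2$ the spectral norm. *)

(* Defs.v *)
From HB Require Import structures.
From mathcomp Require Import all_boot all_order all_algebra.
From mathcomp Require Import all_classical all_reals all_analysis.

Set Implicit Arguments.
Unset Strict Implicit.
Unset Printing Implicit Defensive.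

Import Order.TTheory GRing.Theory Num.Theory.
Import numFieldNormedType.Exports.

Local Open Scope classical_set_scope.
Local Open Scope ring_scope.

(* The library's norm `|x| on matrices is the max norm, not the Euclidean one. *)
Definition euclid_norm (R : realType) (n : nat) (x : 'cV[R]_n) : R :=
  Num.sqrt (\sum_(i < n) x i 0 ^+ 2).

(* The unit ball, rather than the unit sphere, makes the set nonempty also when
   n = 0. Real-valued sup is 0 by convention on unbounded sets; the lemma
   spectral_norm_has_sup below shows that this case never occurs. *)
Definition spectral_norm (R : realType) (m n : nat) (A : 'M[R]_(m, n)) : R :=
  sup [set euclid_norm (A *m x) | x in [set x : 'cV[R]_n | euclid_norm x <= 1]].

Definition psdmx (R : realType) (n : nat) (A : 'M[R]_n) : Prop :=
  A^T = A /\ forall x : 'cV[R]_n, 0 <= (x^T *m A *m x) 0 0.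

Definition hadamard (R : realType) (m n : nat) (A B : 'M[R]_(m, n)) :
    'M[R]_(m, n) :=
  map2_mx *%R A B.

(* mx_norm A is the maximum of the absolute values of the entries of A. *)
Definition bounded_entries (R : realType) (m n : nat) (A : 'M[R]_(m, n)) : Prop :=
  mx_norm A <= 1.

Lemma spectral_norm_has_sup (R : realType) (m n : nat) (A : 'M[R]_(m, n)) :
  has_sup [set euclid_norm (A *m x) |
           x in [set x : 'cV[R]_n | euclid_norm x <= 1]].
Proof.
split.
  exists (euclid_norm (A *m (0 : 'cV[R]_n))), 0 => //=.
  by rewrite /euclid_norm big1 ?sqrtr0// => i _; rewrite mxE expr0n.
exists (Num.sqrt (\sum_(i < m) (\sum_(j < n) `|A i j|) ^+ 2)) => _ [x /= x1 <-].
apply: ler_wsqrtr; apply: ler_sum => i _.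
have xj j : `|x j 0| <= 1.
  rewrite -sqrtr_sqr; apply: le_trans x1; apply: ler_wsqrtr.
  by rewrite (bigD1 j)//= lerDl sumr_ge0// => k _; exact: sqr_ge0.
rewrite -[leLHS]real_normK ?num_real// lerXn2r ?nnegrE ?sumr_ge0//.
rewrite mxE (le_trans (ler_norm_sum _ _ _))// ler_sum// => j _.
by rewrite normrM ler_piMr.
Qed.

(* Main.v *)
(* A positive semidefinite [A] is a sum of rank-one matrices [v v^T], obtained
   by eliminating one nonzero diagonal entry at a time. Hence
   [y^T (A o B) x] is the sum over [v] of [(v o y)^T B (v o x)], and each term
   is at most [||B|| / 2 * (|v o y|^2 + |v o x|^2)]. The sum over [v] of
   [|v o y|^2] is that of [A i i * y_i^2], which is at most [|y|^2] when the
   diagonal of [A] is bounded by 1; so [||A o B|| <= ||B||]. Apply this to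
   [B = 1 - S]. *)
Require Import Defs.
From HB Require Import structures.
From mathcomp Require Import all_boot all_order all_algebra.
From mathcomp Require Import all_classical all_reals all_analysis.
From mathcomp Require Import ring lra.

Set Implicit Arguments.
Unset Strict Implicit.
Unset Printing Implicit Defensive.

Import Order.TTheory GRing.Theory Num.Theory.

Local Open Scope classical_set_scope.
Local Open Scope ring_scope.

Section PositiveSemidefinite.
Variables (R : realType) (n : nat).
Implicit Types (A : 'M[R]_n) (x : 'cV[R]_n).

Local Notation unit_col i := (delta_mx i 0 : 'cV[R]_n).

Lemma psdmx_sym A i j : psdmx A -> A i j = A j i.
Proof. by case=> AT _; rewrite -[in LHS]AT mxE. Qed.

Lemma mulmx_delta_form A x i :
  ((unit_col i)^T *m A *m x) 0 0 = \sum_j A i j * x j 0.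
Proof. by rewrite trmx_delta -rowE mxE; apply: eq_bigr => j _; rewrite mxE. Qed.

(** Symmetry merges the two cross terms. The next three facts all come from this quadratic in [t],
    by a suitable choice of [x] and [t]. *)
Lemma psdmx_form_shift A x i t : psdmx A ->
  ((x - t *: unit_col i)^T *m A *m (x - t *: unit_col i)) 0 0 =
  (x^T *m A *m x) 0 0 - 2 * t * (\sum_j A i j * x j 0) + t ^+ 2 * A i i.
Proof.
move=> Apsd; have [AT _] := Apsd; set e := unit_col i.
have xAe : (x^T *m A *m e) 0 0 = \sum_j A i j * x j 0.
  rewrite -mulmx_delta_form -/e; transitivity ((e^T *m A *m x)^T 0 0).
    by rewrite !trmx_mul trmxK AT mulmxA.
  by rewrite mxE.
have eAe : (e^T *m A *m e) 0 0 = A i i.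
  rewrite mulmx_delta_form (bigD1 i)//= big1 ?addr0; last first.
    by move=> j ji; rewrite mxE (negbTE ji) mulr0.
  by rewrite mxE !eqxx mulr1.
have eAx := mulmx_delta_form A x i.
have -> : (x - t *: e)^T = x^T - t *: e^T by rewrite linearB /= linearZ.
rewrite !mulmxBl !mulmxBr -!scalemxAl -!scalemxAr.
move: xAe eAe eAx; rewrite -/e.
move: (x^T *m A *m x) (x^T *m A *m e) (e^T *m A *m e) (e^T *m A *m x).
by move=> p q r s qE rE sE; rewrite !mxE qE rE sE; ring.
Qed.

Lemma psdmx_diag_ge0 A i : psdmx A -> 0 <= A i i.
Proof.
move=> Apsd; have [_ /(_ (0 - 1 *: unit_col i))] := Apsd.
rewrite psdmx_form_shift// mulmx0 mxE big1; last by move=> j _; rewrite mxE mulr0.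
by rewrite mulr0 subrr add0r expr1n mul1r.
Qed.

(** When [A i i = 0], the form at [unit_col j - t *: unit_col i] is affine in [t] with slope
    [- 2 * A i j]; it stays nonnegative for all [t] only if the slope vanishes. *)
Lemma psdmx_diag0 A i j : psdmx A -> A i i = 0 -> A i j = 0.
Proof.
move=> Apsd Aii; apply/eqP; apply: contraT => Aij0.
pose q := ((unit_col j)^T *m A *m unit_col j) 0 0.
(* This [t] solves [q - 2 * t * A i j = -1], contradicting nonnegativity. *)
have [_ /(_ (unit_col j - ((q + 1) / (2 * A i j)) *: unit_col i))] := Apsd.
rewrite psdmx_form_shift// -/q Aii mulr0 addr0.
have -> : \sum_k A i k * unit_col j k 0 = A i j.
  rewrite (bigD1 j)//= big1 ?addr0 ?mxE ?eqxx ?mulr1// => k kj.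
  by rewrite mxE (negbTE kj) mulr0.
have -> : q - 2 * ((q + 1) / (2 * A i j)) * A i j = -1 by field.
by rewrite lerNr oppr0 ler10.
Qed.

(** One step of symmetric Gaussian elimination (a Schur complement). The new form at [x] is the
    minimum over [t] of the form of [A] at [x - t *: unit_col i], hence nonnegative. *)
Lemma psdmx_eliminate A i : psdmx A -> A i i != 0 ->
  psdmx (A - (A i i)^-1 *: (col i A *m (col i A)^T)).
Proof.
move=> Apsd Aii0; have [AT Aq] := Apsd; split.
  by rewrite linearB /= linearZ /= trmx_mul trmxK AT.
move=> x.
(* The minimizing shift: with [s] the sum, the value there is the form at [x] minus
   [s ^+ 2 / A i i]. *)
have := Aq (x - ((A i i)^-1 * \sum_j A i j * x j 0) *: unit_col i).
rewrite psdmx_form_shift//; set s := \sum_j _.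
have Ax : ((col i A)^T *m x) 0 0 = s.
  by rewrite mxE; apply: eq_bigr => j _; rewrite !mxE psdmx_sym.
have xA : (x^T *m col i A) 0 0 = s.
  by rewrite -Ax !mxE; apply: eq_bigr => j _; rewrite !mxE mulrC.
have xAAx : (x^T *m (col i A *m (col i A)^T) *m x) 0 0 = s ^+ 2.
  by rewrite mulmxA -mulmxA mxE big_ord1 Ax xA expr2.
rewrite mulmxBr mulmxBl -scalemxAr -scalemxAl.
rewrite [X in _ -> 0 <= X]mxE [X in _ -> 0 <= _ + X]mxE.
rewrite [X in _ -> 0 <= _ - X]mxE xAAx.
by congr (0 <= _); field.
Qed.

(** Induction on the number of nonzero diagonal entries. Once there are none, [psdmx_diag0] makes
    the whole matrix zero and the empty sum suffices. *)
Lemma psdmx_gram A : psdmx A ->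
  exists vs : seq 'cV[R]_n, A = \sum_(v <- vs) v *m v^T.
Proof.
have [k] := ubnP #|[set i | A i i != 0]%SET|.
elim: k A => // k IHk A ltAk Apsd.
have [/existsP[i Aii0]|/existsPn diag0] := boolP [exists i, A i i != 0]; last first.
  exists [::]; rewrite big_nil; apply/matrixP => i j; rewrite mxE.
  by apply: psdmx_diag0 => //; apply/eqP; rewrite -[_ == _]negbK diag0.
have Aii_ge0 := psdmx_diag_ge0 i Apsd.
pose A' := A - (A i i)^-1 *: (col i A *m (col i A)^T).
have A'E j : A' j j = A j j - (A i i)^-1 * A j i ^+ 2.
  by rewrite !mxE big_ord1 !mxE expr2.
have [||vs A'vs] := IHk A'; last 1 first.
- exists ((Num.sqrt (A i i))^-1 *: col i A :: vs).
  rewrite big_cons -A'vs linearZ /= -scalemxAl -scalemxAr scalerA.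
  by rewrite -expr2 exprVn sqr_sqrtr// addrC subrK.
(* The count drops: entry [i] of the diagonal becomes zero, and a diagonal zero at [j] persists
   because it forces [A j i = 0]. *)
- rewrite -ltnS (leq_trans _ ltAk)// ltnS; apply: proper_card.
  apply/properP; split.
    apply/fintype.subsetP => j; rewrite !inE; apply: contraNN => /eqP Ajj.
    by rewrite A'E (psdmx_diag0 i Apsd Ajj) Ajj expr0n mulr0 subrr.
  by exists i; rewrite !inE ?Aii0// A'E expr2 mulKf// subrr eqxx.
- exact: psdmx_eliminate.
Qed.

End PositiveSemidefinite.

Section SpectralNorm.
Variables (R : realType).

Lemma euclid_norm_ge0 n (x : 'cV[R]_n) : 0 <= euclid_norm x.
Proof. exact: sqrtr_ge0. Qed.

Lemma sqr_euclid_norm n (x : 'cV[R]_n) :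
  euclid_norm x ^+ 2 = \sum_i x i 0 ^+ 2.
Proof. by rewrite sqr_sqrtr// sumr_ge0// => i _; exact: sqr_ge0. Qed.

Lemma euclid_normZ n a (x : 'cV[R]_n) :
  euclid_norm (a *: x) = `|a| * euclid_norm x.
Proof.
rewrite /euclid_norm; under eq_bigr do rewrite mxE exprMn.
by rewrite -mulr_sumr sqrtrM ?sqr_ge0// sqrtr_sqr.
Qed.

Lemma euclid_norm0 n : euclid_norm (0 : 'cV[R]_n) = 0.
Proof. by rewrite -(scale0r 0) euclid_normZ normr0 mul0r. Qed.

Lemma euclid_norm_eq0 n (x : 'cV[R]_n) : euclid_norm x = 0 -> x = 0.
Proof.
move=> x0; have /eqP := sqr_euclid_norm x.
rewrite x0 expr0n eq_sym psumr_eq0 => [/allP xi0|i _]; last exact: sqr_ge0.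
apply/matrixP => i j; rewrite ord1 mxE; apply/eqP.
by rewrite -sqrf_eq0 (implyP (xi0 i _))// mem_index_enum.
Qed.

Lemma euclid_norm_mulmx_le m n (B : 'M[R]_(m, n)) x :
  euclid_norm (B *m x) <= spectral_norm B * euclid_norm x.
Proof.
have [x0|x0] := eqVneq (euclid_norm x) 0.
  by rewrite (euclid_norm_eq0 x0) mulmx0 !euclid_norm0 mulr0.
have xgt0 : 0 < euclid_norm x by rewrite lt_def x0 euclid_norm_ge0.
rewrite -ler_pdivrMr// mulrC -[X in X * _]ger0_norm ?invr_ge0 ?euclid_norm_ge0//.
rewrite -euclid_normZ scalemxAr.
apply: ub_le_sup; first by have [] := spectral_norm_has_sup B.
exists ((euclid_norm x)^-1 *: x) => //=.
by rewrite euclid_normZ ger0_norm ?invr_ge0 ?euclid_norm_ge0// mulVf.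
Qed.

Lemma spectral_norm_ge0 m n (B : 'M[R]_(m, n)) : 0 <= spectral_norm B.
Proof.
apply: ub_le_sup; first by have [] := spectral_norm_has_sup B.
by exists 0; rewrite /= ?mulmx0 euclid_norm0.
Qed.

(** The bound uses a sum of squares rather than a product of norms so that it can be added up over
    the vectors [v] of a Gram decomposition with no further Cauchy-Schwarz inequality. *)
Lemma bilinear_le_spectral_norm m n (B : 'M[R]_(m, n)) (y : 'cV_m) (x : 'cV_n) :
  2 * (\sum_i \sum_j y i 0 * B i j * x j 0) <=
  spectral_norm B * (\sum_i y i 0 ^+ 2 + \sum_j x j 0 ^+ 2).
Proof.
set b := spectral_norm B.
have b0 : 0 <= b := spectral_norm_ge0 B.
have Bx := euclid_norm_mulmx_le B x.
have -> : \sum_i \sum_j y i 0 * B i j * x j 0 = \sum_i y i 0 * (B *m x) i 0.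
  apply: eq_bigr => i _; rewrite mxE mulr_sumr.
  by apply: eq_bigr => j _; rewrite mulrA.
(* The main case multiplies the goal by [b], which must be positive; if [b = 0], then
   [B *m x = 0]. *)
have [b_eq0|b_neq0] := eqVneq b 0.
  have -> : B *m x = 0.
    apply/euclid_norm_eq0/le_anti.
    by rewrite euclid_norm_ge0 (le_trans Bx)// -/b b_eq0 mul0r.
  by rewrite b_eq0 mul0r big1 ?mulr0// => i _; rewrite mxE mulr0.
have bgt0 : 0 < b by rewrite lt_def b_neq0.
rewrite -(ler_pM2l bgt0).
have sqBx : \sum_i (B *m x) i 0 ^+ 2 <= b ^+ 2 * \sum_j x j 0 ^+ 2.
  by rewrite -!sqr_euclid_norm -exprMn lerXn2r// nnegrE ?mulr_ge0 ?euclid_norm_ge0.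
(* This bound exceeds the left side by the sum of the squares of [b * y i 0 - (B *m x) i 0]. *)
apply: (@le_trans _ _ (b ^+ 2 * \sum_i y i 0 ^+ 2 + \sum_i (B *m x) i 0 ^+ 2)).
  rewrite !mulr_sumr -big_split/=; apply: ler_sum => i _.
  have := sqr_ge0 (b * y i 0 - (B *m x) i 0); nra.
by rewrite mulrA -expr2 mulrDr lerD2l.
Qed.

(** Converse of the previous bound. For [x] in the unit ball, testing with [B *m x] normalized to
    length 1 gives twice the norm of [B *m x] on the left and at most [2 * c] on the right. *)
Lemma spectral_norm_le_bilinear m n (B : 'M[R]_(m, n)) c : 0 <= c ->
  (forall (y : 'cV_m) (x : 'cV_n), 2 * (\sum_i \sum_j y i 0 * B i j * x j 0) <=
     c * (\sum_i y i 0 ^+ 2 + \sum_j x j 0 ^+ 2)) ->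
  spectral_norm B <= c.
Proof.
move=> c0 Bc; apply: ge_sup; first by have [] := spectral_norm_has_sup B.
move=> _ [x /= x1 <-].
set y := B *m x; have [->//|y0] := eqVneq (euclid_norm y) 0.
have := Bc ((euclid_norm y)^-1 *: y) x.
have -> : \sum_i \sum_j ((euclid_norm y)^-1 *: y) i 0 * B i j * x j 0 =
    euclid_norm y.
  transitivity ((euclid_norm y)^-1 * \sum_i y i 0 ^+ 2).
    rewrite mulr_sumr; apply: eq_bigr => i _.
    have yE : y i 0 = \sum_j B i j * x j 0 by rewrite /y mxE.
    rewrite expr2 {2}yE mulrA mulr_sumr.
    by apply: eq_bigr => j _; rewrite [(_ *: y) i 0]mxE mulrA.
  by rewrite -sqr_euclid_norm expr2 mulKf.
rewrite -!sqr_euclid_norm euclid_normZ ger0_norm ?invr_ge0 ?euclid_norm_ge0//.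
rewrite mulVf// expr1n => ly.
have x21 : euclid_norm x ^+ 2 <= 1 by rewrite expr_le1// euclid_norm_ge0.
by nra.
Qed.

(** Schur's bound: Hadamard multiplication by a positive semidefinite matrix scales the spectral
    norm by at most its largest diagonal entry, here at most 1. *)
Lemma spectral_norm_hadamard_le n (A B : 'M[R]_n) :
  psdmx A -> (forall i, A i i <= 1) ->
  spectral_norm (hadamard A B) <= spectral_norm B.
Proof.
move=> Apsd A1; have [vs Avs] := psdmx_gram Apsd.
have AE i j : A i j = \sum_(v <- vs) v i 0 * v j 0.
  rewrite [in LHS]Avs summxE; apply: eq_bigr => v _.
  by rewrite mxE big_ord1 mxE.
have sum_sqr (y : 'cV[R]_n) :
    \sum_(v <- vs) \sum_i (hadamard v y) i 0 ^+ 2 <= \sum_i y i 0 ^+ 2.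
  rewrite exchange_big /=; apply: ler_sum => i _.
  under eq_bigr do rewrite mxE exprMn expr2.
  by rewrite -mulr_suml -AE ler_piMl ?sqr_ge0.
apply: spectral_norm_le_bilinear => [|y x]; first exact: spectral_norm_ge0.
(* Each factor [v i 0 * v j 0] of [A i j] splits between [y] and [x], leaving [B] untouched. *)
have -> : \sum_i \sum_j y i 0 * hadamard A B i j * x j 0 =
    \sum_(v <- vs) \sum_i \sum_j hadamard v y i 0 * B i j * hadamard v x j 0.
  rewrite [RHS]exchange_big /=; apply: eq_bigr => i _.
  rewrite [RHS]exchange_big /=; apply: eq_bigr => j _.
  rewrite mxE AE mulr_suml mulr_sumr mulr_suml.
  by apply: eq_bigr => v _; rewrite !mxE; ring.
apply: (@le_trans _ _ (\sum_(v <- vs) spectral_norm B *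
    (\sum_i hadamard v y i 0 ^+ 2 + \sum_j hadamard v x j 0 ^+ 2))).
  by rewrite mulr_sumr; apply: ler_sum => v _; exact: bilinear_le_spectral_norm.
by rewrite -mulr_sumr big_split/= ler_wpM2l ?spectral_norm_ge0// lerD.
Qed.

End SpectralNorm.

Theorem theorem2 (R : realType) (n : nat) (eps : R) (S : 'M[R]_n)
  (heps : 0 < eps)
  (hS : spectral_norm (const_mx 1 - S) <= eps * n%:R)
  (A : 'M[R]_n) (hA : psdmx A) (hbA : bounded_entries A) :
  spectral_norm (A - hadamard A S) <= eps * n%:R.
Proof.
(* The all-ones matrix is the unit of the Hadamard product. *)
have -> : A - hadamard A S = hadamard A (const_mx 1 - S).
  by apply/matrixP => i j; rewrite !mxE mulrBr mulr1.
apply: le_trans hS; apply: spectral_norm_hadamard_le => // i.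
apply: le_trans (ler_norm _) (le_trans _ hbA).
rewrite mx_normrE.
exact: (le_bigmax _ (fun ij : 'I_n * 'I_n => `|A ij.1 ij.2|) (i, i)).
Qed.
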